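(* Let $k\ge 2$ be an integer and let $D$ be a bipartite oriented graph with $\delta^0(D)\ge \frac{3k}{8}+2$. Then $D$ contains every oriented path with two blocks of length $k$.
   Context: An oriented graph is a digraph containing no directed cycle of length at most two (no loops, and no two vertices $x,y$ with both arcs $(x,y)$ and $(y,x)$). A digraph $D$ is bipartite if its vertex set admits a partition $V(D)=V_1\cup V_2$ such that every arc has one end in $V_1$ and the other in $V_2$. The minimum semidegree $\delta^0(D)$ is the minimum of the minimum out-degree $\delta^+(D)$ and the minimum in-degree $\delta^-(D)$ of $D$. An oriented path is an orientation of an (undirected) path; its length is its total number of arcs. A block of an oriented path is a maximal directed subpath within it. Thus an oriented path with two blocks of length $k$ is, for some integers $s,t\ge 1$ with $s+t=k$, either $P(s,t)$, the oriented path consisting of $s$ consecutive forward arcs followed by $t$ consecutive backward arcs, or $Q(s,t)$, the oriented path consisting of $s$ consecutive backward arcs followed by $t$ consecutive forward arcs. A digraph $D$ contains an oriented path if it has a (not necessarily induced) subdigraph isomorphic to it. *)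

(* Defs.v *)
From mathcomp Require Import all_boot all_order all_algebra.

Set Implicit Arguments.
Unset Strict Implicit.
Unset Printing Implicit Defensive.

(* A digraph is a finType V of vertices with an arc relation e : rel V;
   e x y means that there is an arc from x to y. *)
Section Digraph.

Variables (V : finType) (e : rel V).

Definition oriented_graph : Prop :=
  (forall x, ~~ e x x) /\ (forall x y, ~~ (e x y && e y x)).

Definition bipartite : Prop :=
  exists V1 V2 : {set V},
    [/\ V1 :|: V2 = [set: V], [disjoint V1 & V2] &
        forall x y, e x y ->
          (x \in V1) && (y \in V2) || (x \in V2) && (y \in V1)].

Definition outdeg (x : V) : nat := #|[set y | e x y]|.
Definition indeg (x : V) : nat := #|[set y | e y x]|.

(* Degrees never exceed #|V|, so the default value #|V| does not affect the
   minimum when V is nonempty; for the empty digraph the minimum is 0. *)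
Definition min_outdeg : nat := \big[minn/#|V|]_(x : V) outdeg x.
Definition min_indeg : nat := \big[minn/#|V|]_(x : V) indeg x.
Definition min_semideg : nat := minn min_outdeg min_indeg.

End Digraph.

(* The image of an injective arc-preserving map, with the images of the arcs
   of d, is a subdigraph of e isomorphic to d. *)
Definition contains (V U : finType) (e : rel V) (d : rel U) : Prop :=
  exists f : U -> V, injective f /\ forall x y, d x y -> e (f x) (f y).

Unset Implicit Arguments.

(* The orientation of the path 0 - 1 - ... - size w in which the i-th edge is
   the forward arc i -> i.+1 if the i-th letter of w is true, and the backward
   arc i.+1 -> i if it is false. *)
Definition oriented_path (w : seq bool) : rel 'I_(size w).+1 :=
  fun i j => (j == i.+1 :> nat) && nth false w i
          || (i == j.+1 :> nat) && ~~ nth false w j.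

Definition P (s t : nat) := oriented_path (nseq s true ++ nseq t false).
Definition Q (s t : nat) := oriented_path (nseq s false ++ nseq t true).

(* Main.v *)
Require Import Defs.
From mathcomp Require Import all_boot all_order all_algebra.
From mathcomp Require Import zify.

Set Implicit Arguments.
Unset Strict Implicit.
Unset Printing Implicit Defensive.

(** Reversing all arcs exchanges P(s,t) and Q(s,t) and preserves the hypotheses,
    so it suffices to find a fork: a vertex with two outgoing directed paths, of
    lengths at least s and t and disjoint except at that vertex. Let d be the
    minimum semidegree and t <= s; the hypothesis says 8d >= 3(s+t) + 16.

    The out-neighbours of the end of a maximal directed path are on the path, on
    one side of the bipartition, and do not include the predecessor of the end;
    hence directed cycles with more than 2d vertices exist ([end_cycle]).

    If some arc u -> w is on no closed walk, then the part of the digraph that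
    reaches u is disjoint from the part reachable from w, and each of them
    contains a path on more than 2d vertices. This gives a directed path on at
    least 4d vertices, and a fork if s <= 2d ([one_way_arc]).

    Otherwise all components are strongly connected. Let C be a longest cycle,
    of length L. If C covers its component, then L >= 4d, and the chords of C at
    a single vertex already yield a fork ([isolated_cycle]). If not, let R be a
    longest path off C in the component of C, on r vertices. The in-neighbours
    of the first vertex of R and the out-neighbours of its last vertex are on C
    or R. So if r <= 2d, there are sets A and B of more than d - r/2 vertices of
    C such that R can be entered from each vertex of A and left to each vertex
    of B. Let a in A, b in B, and let g be the distance from a to b along C.
    Passing from a through R to b gives a cycle, so g > r by the choice of C; it
    also gives a fork at a with branches of lengths g - 1 and r + L - g. Thus
    the maximality of C, and the absence of forks, each exclude a run of
    consecutive values of g. Now if h consecutive possible values of g (all of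
    one parity) do not occur, then |A| + |B| + h <= L/2 + 1 ([gap_between]). The
    first run yields L + r >= 4d - 1 ([longest_cycle_detour]). With this, the
    second run yields 4d <= s + t + r + 1, which is impossible if r < t
    ([short_detour_fork]). So there is a fork when r < t; and when r >= t and
    s <= 2d, leaving C along a path on t vertices gives one ([two_way_arcs]).

    These structures also contain a directed path on at least 4d - 1 vertices:
    around C and then along R, or along another cycle if r > 2d. Such a path
    forces a fork if t < d, by counting the out-neighbours of the end of a
    second maximal path from its start ([long_path_fork]). If t >= d, then
    s <= 2d, and the previous cases apply. *)

(** * Finite counting *)

Lemma bigminn_le (T : eqType) (r : seq T) (F : T -> nat) m x :
  x \in r -> \big[minn/m]_(i <- r) F i <= F x.
Proof.
elim: r => // y r IH; rewrite inE big_cons geq_min => /orP[/eqP->|/IH ->].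
  by rewrite leqnn.
by rewrite orbT.
Qed.

Lemma bigminn_le_idx (T : Type) (r : seq T) (F : T -> nat) m :
  \big[minn/m]_(i <- r) F i <= m.
Proof. by elim: r => [|y r IH]; rewrite ?big_nil // big_cons geq_min IH orbT. Qed.

(** Starting point of all the extremal choices below: duplicate-free sequences
    over a finite type have bounded length. *)
Lemma ex_longest (T : finType) (P : pred (seq T)) (s0 : seq T) :
    P s0 -> (forall s, P s -> uniq s) ->
  exists2 s, P s & forall s', P s' -> size s' <= size s.
Proof.
move=> Ps0 Puniq.
pose Q n := [exists u : n.-tuple T, P u].
have exQ : exists n, Q n.
  by exists (size s0); apply/existsP; exists (in_tuple s0).
have ubQ n : Q n -> n <= #|T|.
  by case/existsP=> u /Puniq /card_uniqP uE; rewrite -(size_tuple u) -uE max_card.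
case: (ex_maxnP exQ ubQ) => n /existsP[u Pu] umax.
exists u => // s' Ps'; rewrite size_tuple; apply: umax.
by apply/existsP; exists (in_tuple s').
Qed.

Lemma count_parity_iota b a n : (count (fun i => odd i == b) (iota a n)).*2 <= n.+1.
Proof.
elim/ltn_ind: n a => -[|[|n]] IH a //=.
  by case: (_ == _).
move: (IH n (leqnSn _) a.+2); rewrite /= {IH}.
by case: (odd a); case: b => /=; lia.
Qed.

(** The windows are made of consecutive integers, so that [count_parity_iota]
    counts a residue class modulo 2 in each of them. *)
Lemma mem_windows m s t a b j : j < m -> [|| j < t, a < j < s | b < j] ->
  j \in iota 0 t ++ iota a.+1 (s - a.+1) ++ iota b.+1 (m - b.+1).
Proof.
move=> jm; rewrite !mem_cat !mem_iota => /or3P[jt|/andP[aj js]|bj].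
- by rewrite jt.
- by apply/or3P/Or32; rewrite aj subnKC ?(leq_trans aj (ltnW js)).
- by apply/or3P/Or33; rewrite bj subnKC ?(leq_trans bj (ltnW jm)).
Qed.

Lemma card_le_seq (T : finType) (N : {set T}) (s : seq T) :
  {subset N <= s} -> #|N| <= size s.
Proof.
move=> sub; rewrite cardE; apply: uniq_leq_size; first exact: enum_uniq.
by move=> x; rewrite mem_enum; apply: sub.
Qed.

Lemma card_le_count (T : finType) (N : {set T}) (f : nat -> T) P (l : seq nat) :
    (forall v, v \in N -> exists2 j, (j \in l) && P j & v = f j) ->
  #|N| <= count P l.
Proof.
move=> NP; rewrite -size_filter -(size_map f); apply: card_le_seq => v /NP[j].
by rewrite andbC -mem_filter => jl ->; apply: map_f.
Qed.

Lemma first_split (T : Type) (P : pred T) s : has P s ->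
  exists z s1 s2, [/\ s = s1 ++ z :: s2, P z & ~~ has P s1].
Proof. by case/split_find=> z s1 s2 Pz s1N; exists z, s1, s2; rewrite cat_rcons. Qed.

Lemma count_period (P : pred nat) n a : (forall i, P (i + n) = P i) ->
  count P (iota a n) = count P (iota 0 n).
Proof.
move=> per; elim: a => // a <-.
have : count P (iota a n.+1) = count P (iota a n) + P a.
  by rewrite -addn1 iotaD count_cat /= per addn0.
by rewrite /=; lia.
Qed.

(** This is the estimate |A + {0, ..., h-1}| >= min(n, |A| + h - 1) in Z/n, for
    subsets of Z/n encoded by predicates of period n. If no element of A is
    followed by one of B at a distance less than h, then the window of length n
    that ends at an element of B contains, besides the elements of A and those
    of B, the integers k + 1, ..., k + h - 1, where k is its last element of A.
    Hence |A| + |B| + h - 1 <= n. *)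
Lemma periodic_gap (A B : pred nat) n h :
    (forall i, A (i + n) = A i) -> (forall i, B (i + n) = B i) ->
    has A (iota 0 n) -> has B (iota 0 n) -> 0 < h ->
    n.+1 < count A (iota 0 n) + count B (iota 0 n) + h ->
  exists k m, [/\ m < h, A k & B (k + m)].
Proof.
move=> perA perB hasA /hasP[b _ Bb] h0.
rewrite -(count_period b.+1 perA) -(count_period b.+1 perB) => big.
pose Q k := (b < k <= b + n) && A k.
have exQ : exists k, Q k.
  move: hasA; rewrite has_count -(count_period b.+1 perA) -has_count.
  by case/hasP=> k; rewrite mem_iota addSn ltnS => kb Ak; exists k; rewrite /Q kb.
have ubQ k : Q k -> k <= b + n by case/andP=> /andP[].
(* k is the last element of A in the window b+1, ..., b+n. *)
case: (ex_maxnP exQ ubQ) => k /andP[/andP[bk kn] Ak] kmax.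
have [/hasP[m]|nB] := boolP (has (fun m => B (k + m)) (iota 0 h)).
  by rewrite mem_iota => mh Bm; exists k, m.
have [/hasP[j _ /andP[Aj Bj]]|nAB] := boolP (has (predI A B) (iota b.+1 n)).
  by exists j, 0; rewrite addn0.
have kh : k + h <= b + n.
  rewrite leqNgt; apply/negP => khn; case/negP: nB; apply/hasP; exists (b + n - k).
    by rewrite mem_iota /=; lia.
  by rewrite subnKC // perB.
(* The h - 1 integers after k are free from A and B. *)
exfalso; move: big; rewrite -count_predUI.
have -> : count (predI A B) (iota b.+1 n) = 0.
  by apply/eqP; rewrite -leqn0 leqNgt -has_count.
have -> : iota b.+1 n =
    iota b.+1 (k - b) ++ iota k.+1 h.-1 ++ iota (k + h) (b + n - (k + h)).+1.
  rewrite (_ : k.+1 = b.+1 + (k - b)); last by lia.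
  rewrite (_ : k + h = b.+1 + (k - b) + h.-1); last by lia.
  by rewrite -!iotaD; congr iota; lia.
rewrite !count_cat.
have -> : count (predU A B) (iota k.+1 h.-1) = 0.
  apply/eqP; rewrite -leqn0 leqNgt -has_count; apply/hasPn => j.
  rewrite mem_iota => jk /=.
  apply/norP; split.
    apply/negP=> Aj; have := kmax j; rewrite /Q Aj; lia.
  apply/negP=> Bj; case/negP: nB; apply/hasP; exists (j - k).
    by rewrite mem_iota; lia.
  by rewrite subnKC //; lia.
have := count_size (predU A B) (iota b.+1 (k - b)).
have := count_size (predU A B) (iota (k + h) (b + n - (k + h)).+1).
by rewrite !size_iota; lia.
Qed.

(** * Bipartite oriented graphs and forks *)

Section Digraphs.
Variable V : finType.
Implicit Types (e : rel V) (c : V -> bool) (x y z u v w : V) (p q : seq V).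
Implicit Types (f : nat -> V) (d : nat).

Definition arev e : rel V := fun x y => e y x.

(** The colouring [c] records the two sides of the bipartition, which turns the
    position of a vertex along a path into a parity. *)
Definition bip_semideg e (c : V -> bool) d : Prop :=
  [/\ forall x y, e x y -> c y = ~~ c x,
      forall x y, e x y -> ~~ e y x,
      forall x, d <= outdeg e x & forall x, d <= indeg e x].

Lemma bip_semideg_rev e c d : bip_semideg e c d -> bip_semideg (arev e) c d.
Proof.
case=> ec ea eo ei; split=> // x y; rewrite /arev => exy; last exact: ea.
by rewrite (ec _ _ exy) negbK.
Qed.

(** Up to truncation of its two branches, a fork is a copy of Q(s,t) in [e] and
    a copy of P(s,t) in the reversed digraph. *)
Definition fork e s t : Prop :=
  exists v p q, [/\ path e v p, path e v q, uniq (v :: p ++ q),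
                    s <= size p & t <= size q].

Lemma forkC e s t : fork e s t -> fork e t s.
Proof.
case=> v [p] [q] [pp pq u sp sq]; exists v, q, p; split=> //.
by rewrite /= mem_cat orbC -mem_cat uniq_catC.
Qed.

Lemma forkW e a b a' b' : fork e a b -> a' <= a -> b' <= b -> fork e a' b'.
Proof.
case=> v [p [q [pp pq u sp sq]]] aa bb.
by exists v, p, q; split; rewrite ?(leq_trans aa) ?(leq_trans bb).
Qed.

Lemma path_rev e x p :
  path e x p -> path (arev e) (last x p) (rev (belast x p)).
Proof. by rewrite rev_path. Qed.

(** Allowing a forbidden set [X] makes it possible to extend a path inside the
    complement of a structure that is already in place. *)
Lemma maximal_path e (X : {pred V}) x :
  exists p, [/\ path e x p, uniq (x :: p), {in p, forall y, y \notin X} &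
    forall y, e (last x p) y -> y \notin X -> y \in x :: p].
Proof.
pose P s := [&& uniq (x :: s), path e x s & all [predC X] s].
have [||p /and3P[up pp /allP Xp] pmax] := @ex_longest V P [::].
- by [].
- by move=> s /and3P[/andP[]].
exists p; split=> // y ey Xy; apply: contraT => yp.
have/pmax : P (rcons p y).
  rewrite /P -rcons_cons rcons_uniq yp up rcons_path pp ey all_rcons /= Xy.
  exact/allP.
by rewrite size_rcons ltnn.
Qed.

Section Alternating.
Variables (e : rel V) (c : V -> bool) (d : nat).
Hypothesis eG : bip_semideg e c d.

Lemma arc_color x y : e x y -> c y = ~~ c x.
Proof. by case: eG => H _ _ _; apply: H. Qed.
Lemma arc_asym x y : e x y -> ~~ e y x.
Proof. by case: eG => _ H _ _; apply: H. Qed.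
Lemma arc_irrefl x : ~~ e x x.
Proof. by apply/negP=> ex; move: (arc_asym ex); rewrite ex. Qed.
Lemma outdeg_ge x : d <= outdeg e x. Proof. by case: eG. Qed.
Lemma indeg_ge x : d <= indeg e x. Proof. by case: eG. Qed.

Lemma path_color x p i : path e x p -> i <= size p ->
  c (nth x (x :: p) i) = c x (+) odd i.
Proof.
move=> pp; elim: i => [|i IH] ip; first by rewrite addbF.
have /(pathP x)/(_ i ip) /arc_color -> := pp.
by rewrite IH 1?ltnW //= addbN.
Qed.

(** At most half of the vertices of the path are on the side opposite to its
    end; when the path is nontrivial the predecessor of the end is one of them,
    and it is not an out-neighbour of the end since the digraph is oriented. *)
Lemma card_outnbrs_on_path x p : path e x p ->
  (#|[set y in x :: p | e (last x p) y]|).*2 < size (x :: p).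
Proof.
move=> pp; set N := [set y in _ | _].
case: (lastP p) pp @N => [|p' z] pp N.
  rewrite (_ : N = set0) ?cards0 //; apply/setP => y; rewrite !inE /=.
  by apply/negP=> /andP[/eqP->]; apply/negP/arc_irrefl.
have [pp' ez] : path e x p' /\ e (last x p') z.
  by move: pp; rewrite rcons_path => /andP[].
rewrite [size _]/= size_rcons.
suff : #|N| <= count (fun i => odd i == odd (size p')) (iota 0 (size p')).
  by have := count_parity_iota (odd (size p')) 0 (size p'); lia.
apply: (@card_le_count _ _ (fun i => nth x (x :: p') i)) => y.
rewrite inE last_rcons -rcons_cons mem_rcons inE => /andP[yin ey].
have {}yin : y \in x :: p'.
  by case/orP: yin => // /eqP yz; move: ey (arc_irrefl z); rewrite yz => ->.
exists (index y (x :: p')); last by rewrite nth_index.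
have ip : index y (x :: p') < (size p').+1.
  by rewrite -[X in _ < X]/(size (x :: p')) index_mem.
have cy : c y = c x (+) odd (index y (x :: p')).
  by rewrite -(path_color pp') // nth_index.
have cz : c z = c x (+) odd (size p').+1.
  have := arc_color ez; rewrite (last_nth x) (path_color pp') //= => ->.
  by rewrite addbN.
have par : odd (index y (x :: p')) = odd (size p').
  move: (arc_color ey); rewrite cy cz /=.
  by case: (c x); case: (odd _); case: (odd _).
rewrite mem_iota par /= eqxx andbT add0n.
rewrite ltn_neqAle -ltnS ip andbT; apply/eqP=> ie.
have yl : y = last x p' by rewrite (last_nth x) -ie nth_index.
by move: (arc_asym ez); rewrite -yl ey.
Qed.

(** A path that its end cannot leave closes up: the out-neighbour of its end
    that comes first along the path starts a cycle, and this cycle contains all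
    the out-neighbours of the end. *)
Lemma end_cycle x p : path e x p ->
    (forall y, e (last x p) y -> y \in x :: p) -> 0 < d ->
  exists p1 z p2, [/\ x :: p = p1 ++ z :: p2, path e z p2, e (last z p2) z
    & d.*2 < size (z :: p2)].
Proof.
move=> pp out d0.
have hasN : has (e (last x p)) (x :: p).
  have : 0 < outdeg e (last x p) by apply: leq_trans (outdeg_ge _).
  by case/card_gt0P=> y; rewrite inE => ey; apply/hasP; exists y => //; apply: out.
have [z [p1 [p2 [E' ez p1N]]]] := first_split hasN.
have l2 : last z p2 = last x p.
  by rewrite -[RHS](last_cons x x p) E' last_cat last_cons.
have pz : path e z p2.
  move: (E'); case: (p1) => [[<- <-] //|a p1' [_ Ep]].
  by move: pp; rewrite Ep cat_path /= => /and3P[].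
exists p1, z, p2; split=> //; first by rewrite l2.
have := card_outnbrs_on_path pz; apply: leq_ltn_trans; rewrite leq_double.
apply: leq_trans (outdeg_ge (last z p2)) _; apply: subset_leq_card.
apply/subsetP => y; rewrite [y \in _]inE l2 => ey; apply/setIdP; split=> //.
have := out y ey; rewrite E' mem_cat => /orP[yp1|//].
by case/hasP: p1N; exists y.
Qed.

Lemma maximal_path_size x p : path e x p ->
    (forall y, e (last x p) y -> y \in x :: p) ->
  d.*2 < size (x :: p).
Proof.
move=> pp out.
apply: leq_ltn_trans (card_outnbrs_on_path pp); rewrite leq_double.
apply: leq_trans (outdeg_ge (last x p)) (subset_leq_card _).
apply/subsetP => y; rewrite [y \in _]inE => ey; apply/setIdP; split=> //.
exact: out.
Qed.

End Alternating.

(** * Forks from one-way arcs and from long paths *)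

Section Forks.
Variables (e : rel V) (c : V -> bool) (d : nat).
Hypothesis eG : bip_semideg e c d.

(** If [w] cannot reach [u], then the vertices reachable from [w] and those that
    reach [u] are disjoint, so a maximal path out of [w] and a maximal path into
    [u] do not meet. Joined by the arc, they make a long path. The start of the
    path into [u] also lies on a cycle formed by vertices of that path; the
    vertex where the path leaves this cycle for [u] is the centre of a fork,
    with the cycle as one branch and the way through [u] and [w] as the other.
    *)
Lemma one_way_arc u w : e u w -> ~~ connect e w u -> 0 < d ->
  (exists x p, [/\ path e x p, uniq (x :: p) & 4 * d <= (size p).+2]) /\
  fork e d.*2 d.*2.
Proof.
move=> euw Nwu d0.
have [p [pp up _ outp]] := maximal_path e pred0 w.
have [q [pq uq _ outq]] := maximal_path (arev e) pred0 u.
have reG := bip_semideg_rev eG.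
have sp : d.*2 < size (w :: p).
  by apply: (maximal_path_size eG pp) => y ey; apply: outp.
have sq : d.*2 < size (u :: q).
  by apply: (maximal_path_size reG pq) => y ey; apply: outq.
have wp v : v \in w :: p -> connect e w v by move/(path_connect pp).
have qu v : v \in u :: q -> connect e v u.
  move/(path_connect pq); rewrite (connect_rev (arev e)) //.
have dis : ~~ has (mem (u :: q)) (w :: p).
  apply/hasPn => v /wp wv; apply/negP => /qu vu.
  by case/negP: Nwu; apply: connect_trans wv vu.
split.
  exists (last u q), (rev (belast u q) ++ w :: p); split.
  - rewrite cat_path (path_rev pq) /= pp andbT.
    by case: (q) => [|a q'] //=; rewrite rev_cons last_rcons.
  - rewrite -cat_cons -rev_rcons -lastI cat_uniq rev_uniq uq up andbT.
    by apply/hasPn => v vp; rewrite /= mem_rev; apply: (hasPn dis).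
  - rewrite /= size_cat size_rev size_belast /=.
    by move: sp sq => /=; lia.
have [q1 [z [q2 [E pz ez sz]]]] := end_cycle reG pq (fun y ey => outq y ey isT) d0.
exists z, (rev q2), (rev q1 ++ w :: p); split.
- case/lastP: q2 pz ez {E sz} => // q2 y pz; rewrite last_rcons => ezy.
  have := path_rev pz; rewrite belast_rcons rev_cons last_rcons rcons_path.
  by rewrite rev_rcons /= => /andP[-> _]; rewrite andbT.
- rewrite cat_path /= pp andbT.
  case: q1 E => [[<- _] //|_ q1 [<- Eq]].
  have : path (arev e) u (rcons q1 z).
    by move: pq; rewrite Eq -cat_rcons cat_path => /andP[].
  by move/path_rev; rewrite last_rcons belast_rcons rev_cons last_rcons => ->.
- rewrite (perm_uniq (s2 := (u :: q) ++ w :: p)).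
    by rewrite cat_uniq uq up dis.
  by apply/permP => a; rewrite E /= !count_cat !count_rev /=; clear; lia.
- by rewrite size_rev; move: sz => /=; lia.
- by rewrite size_cat; move: sp; lia.
Qed.

(** Let x_0, ..., x_m be a long path and follow a maximal path of r vertices
    that leaves x_0 off it, ending at y. If r < t, then the out-neighbours of y
    are on the two paths. An arc from y to x_i gives a fork at x_0 with branches
    x_1, ..., x_{i-1} and the detour through y to x_i, ..., x_m, of lengths i-1
    and r+m-i+1. Without a fork, i is confined to three windows, whose total
    length, together with r, is about 2t + max(0, 2s-m-r). Only one parity of i
    is possible, so d is at most about half of this, which is too small. *)
Lemma long_path_fork x p s t : path e x p -> uniq (x :: p) -> 4 * d <= (size p).+2 ->
  3 * (s + t) + 16 <= 8 * d -> t < d -> t <= s -> fork e s t.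
Proof.
move=> pp up sp hd td ts.
have [q [pq uq qX outq]] := maximal_path e (mem (x :: p)) x.
set m := size p in sp; set r := size q; set y := last x q in outq.
have upq : uniq (x :: p ++ q).
  rewrite -cat_cons cat_uniq up; move: uq; rewrite cons_uniq => /andP[_ ->].
  rewrite andbT.
  by apply/hasPn => v /qX.
have [tr|rt] := leqP t r.
  by exists x, p, q; split=> //; lia.
(* Positions are counted in [p], which starts at x_1: [j] stands for i-1. *)
have mk j : j < m -> e y (nth x p j) -> fork e j (r + m - j).
  move=> jm ey; exists x, (take j p), (q ++ drop j p); split.
  - by move: pp; rewrite -{1}(cat_take_drop j p) cat_path => /andP[].
  - rewrite cat_path pq (drop_nth x jm) /= ey.
    move: pp; rewrite -{1}(cat_take_drop j.+1 p) cat_path (take_nth x jm).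
    by rewrite last_rcons => /andP[].
  - rewrite (perm_uniq (s2 := x :: p ++ q)) // -{3}(cat_take_drop j p).
    by apply/permP => a; rewrite /= !count_cat; lia.
  - by rewrite size_take jm.
  - by rewrite size_cat size_drop; lia.
case nofork: (all (fun j => e y (nth x p j) ==>
   [|| j < t, r + m - s < j < s | r + m - t < j]) (iota 0 m)); last first.
  case/negbT/allPn: nofork => j; rewrite mem_iota /= add0n negb_imply.
  move=> jm /andP[ey jN].
  have fj := mk j jm ey; have [js|sj] := leqP j (r + m - s).
    by apply/forkC/(forkW fj); lia.
  by apply: (forkW fj); lia.
exfalso.
set N1 := [set v in x :: q | e y v]; set N2 := [set v in p | e y v].
have N1q : #|N1|.*2 <= r by have := card_outnbrs_on_path eG pq; rewrite -/N1 /= ltnS.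
have dN : d <= #|N1| + #|N2|.
  apply: leq_trans (outdeg_ge eG y) _; apply: leq_trans (leq_card_setU N1 N2).
  apply: subset_leq_card; apply/subsetP => v; rewrite [v \in _]inE => eyv.
  apply/setUP; have [vx|vx] := boolP (v \in x :: p); last first.
    by left; apply/setIdP; split=> //; apply: outq.
  move: vx; rewrite inE => /orP[/eqP vE|vp].
    by left; apply/setIdP; split=> //; rewrite vE mem_head.
  by right; apply/setIdP.
pose l1 := iota 0 t.
pose l2 := iota (r + m - s).+1 (s - (r + m - s).+1).
pose l3 := iota (r + m - t).+1 (m - (r + m - t).+1).
(* The parity of the positions in [p] of the out-neighbours of y. *)
pose b := ~~ c y (+) ~~ c x.
have N2p : #|N2| <= count (fun j => odd j == b) (l1 ++ l2 ++ l3).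
  apply: (@card_le_count _ _ (nth x p)) => v /setIdP[vp eyv].
  exists (index v p); last by rewrite nth_index.
  have ip : index v p < m by rewrite index_mem.
  have cv : c v = c x (+) odd (index v p).+1.
    by rewrite -(path_color eG pp) //= nth_index.
  apply/andP; split.
    have /allP/(_ (index v p)) := nofork.
    rewrite mem_iota add0n ip nth_index // eyv.
    by move/(_ isT); apply: mem_windows.
  by move: cv; rewrite (arc_color eG eyv) /b => -> /=; case: (c x); case: (odd _).
move: N2p; rewrite !count_cat.
have := count_parity_iota b 0 t; rewrite -/l1.
have := count_parity_iota b (r + m - s).+1 (s - (r + m - s).+1); rewrite -/l2.
have := count_parity_iota b (r + m - t).+1 (m - (r + m - t).+1); rewrite -/l3.
have := count_size (fun j => odd j == b) l2; rewrite size_iota.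
lia.
Qed.

End Forks.

(** * Detours of a cycle *)

(** A cycle of length [L], unrolled into a periodic sequence of its vertices, so
    that distances along the cycle are differences of indices and no rotation of
    lists is needed. *)
Definition winds e f L : Prop :=
  [/\ 0 < L, forall i, e (f i) (f i.+1) & forall i j, f i = f j <-> i = j %[mod L]].

Lemma cycle_winds e r : cycle e r -> uniq r -> r != [::] ->
  exists2 f, winds e f (size r) &
    forall v, v \in r <-> exists i, v = f i.
Proof.
case: r => // x p pc up _.
pose f i := nth x (x :: p) (i %% (size p).+1).
have fE i : i %% (size p).+1 < size (x :: p) by rewrite ltn_mod.
exists f; last first.
  move=> v; split=> [vp|[i ->]]; last exact: mem_nth.
  exists (index v (x :: p)); rewrite /f modn_small ?nth_index //.
  by rewrite -[X in _ < X]/(size (x :: p)) index_mem.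
split=> // i; last first.
  move=> j; split=> [/eqP|ij]; last by rewrite /f ij.
  by rewrite /f nth_uniq // => /eqP.
have := fE i; rewrite /f -(addn1 i) -(modnDml i 1); set k := i %% _ => kp.
have /(pathP x)/(_ k) := pc; rewrite size_rcons => /(_ kp).
rewrite -rcons_cons !nth_rcons kp if_same addn1.
move: kp; rewrite ltnS leq_eqVlt => /orP[/eqP->|kp].
  by rewrite modnn ltnn.
by rewrite modn_small // kp.
Qed.

Section Winding.
Variables (e : rel V) (f : nat -> V) (L : nat).
Hypothesis fL : winds e f L.

Definition seg a l := [seq f i | i <- iota a l].

Lemma winds_arc i : e (f i) (f i.+1). Proof. by case: fL. Qed.
Lemma winds_eq i j : i = j %[mod L] -> f i = f j. Proof. by case: fL => _ _ H /H. Qed.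
Lemma winds_addL i : f (i + L) = f i. Proof. by apply: winds_eq; rewrite modnDr. Qed.
Lemma size_seg a l : size (seg a l) = l. Proof. by rewrite size_map size_iota. Qed.

Lemma path_seg a l : path e (f a) (seg a.+1 l).
Proof. by elim: l a => //= l IH a; rewrite winds_arc; apply: IH. Qed.

Lemma last_seg a l : last (f a) (seg a.+1 l) = f (a + l).
Proof. by elim: l a => [|l IH] a /=; rewrite ?addn0 // IH addSnnS. Qed.

Lemma uniq_seg a l : l <= L -> uniq (seg a l).
Proof.
move=> lL; rewrite map_inj_in_uniq ?iota_uniq //.
suff H i j : a <= i <= j -> j < a + l -> f i = f j -> i = j.
  move=> i j; rewrite !mem_iota => /andP[ai il] /andP[aj jl] ij.
  by have [ij'|/ltnW ji'] := leqP i j; [apply: H | apply/esym/H]; rewrite ?ai ?aj.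
move=> /andP[ai ij] jl; case: fL => L0 _ inj /inj /esym/eqP.
rewrite eqn_mod_dvd // => dv; apply/eqP; rewrite eqn_leq ij /= -subn_eq0 eqn0Ngt.
by apply/negP=> /dvdn_leq /(_ dv); lia.
Qed.

Lemma seg_index a i : exists2 j, a <= j < a + L & f j = f i.
Proof.
case: (fL) => L0 _ _; exists (a + (i + L * a - a) %% L).
  by rewrite leq_addr ltn_add2l ltn_mod.
apply: winds_eq; rewrite modnDmr subnKC; first by rewrite addnC mulnC modnMDl.
by rewrite (leq_trans _ (leq_addl _ _)) // leq_pmull.
Qed.

(** The chord and the cycle leave f(i) in two ways, and both branches together
    visit each vertex of the cycle once. *)
Lemma winds_chord_fork i g : 0 < g <= L -> e (f i) (f (i + g)) -> fork e g.-1 (L - g).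
Proof.
move=> gL eg; exists (f i), (seg i.+1 g.-1), (seg (i + g) (L - g)).
split; rewrite ?size_seg //.
- exact: path_seg.
- case E: (L - g) => [|l] //=; rewrite eg; exact: path_seg.
- rewrite -[f i :: _]/(seg i g.-1.+1 ++ _) -map_cat prednK; last by case/andP: gL.
  rewrite -iotaD subnKC; last by case/andP: gL.
  exact: uniq_seg.
Qed.

Section Detour.
Variables (z : V) (p : seq V).
Hypotheses (zp : path e z p) (uzp : uniq (z :: p)) (off : forall i, f i \notin z :: p).

Lemma uniq_detour a l q : l <= L -> perm_eq q ((z :: p) ++ seg a l) -> uniq q.
Proof.
move=> lL /perm_uniq->; rewrite cat_uniq uzp uniq_seg // andbT.
by apply/hasPn => v /mapP[i _ ->]; apply: off.
Qed.

(** The two ways to leave f(i) are along the cycle, up to the vertex before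
    f(i+g), and through the detour, which then continues from f(i+g). *)
Lemma detour_fork i g : 0 < g <= L -> e (f i) z -> e (last z p) (f (i + g)) ->
  fork e g.-1 (size (z :: p) + (L - g)).
Proof.
move=> gL ez ep; exists (f i), (seg i.+1 g.-1), ((z :: p) ++ seg (i + g) (L - g)).
split; rewrite ?size_cat ?size_seg //.
- exact: path_seg.
- rewrite cat_path /= ez zp /=; case E: (L - g) => [|l] //=; rewrite ep; exact: path_seg.
- apply: (@uniq_detour i L) => //.
  rewrite -[f i :: _]/(seg i g.-1.+1 ++ _) prednK; last by case/andP: gL.
  have -> : seg i L = seg i g ++ seg (i + g) (L - g).
    by rewrite /seg -map_cat -iotaD subnKC //; case/andP: gL.
  by rewrite perm_catCA.
Qed.

(** The detour replaces the part of the cycle from f(i) to f(i+g). *)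
Lemma detour_cycle i g : 0 < g <= L -> e (f i) z -> e (last z p) (f (i + g)) ->
  exists2 r, cycle e r && uniq r & size r = L - g + size (z :: p) + 1.
Proof.
move=> gL ez ep; exists (seg (i + g) (L - g).+1 ++ z :: p); last first.
  by rewrite size_cat size_seg /=; lia.
apply/andP; split; last first.
  apply: (@uniq_detour (i + g) (L - g).+1); last by rewrite perm_catC.
  by move: gL; clear; lia.
rewrite /= rcons_cat cat_path path_seg last_seg /= rcons_path zp ep andbT.
by rewrite -addnA subnKC ?winds_addL ?ez //; case/andP: gL.
Qed.

End Detour.

Section Colored.
Variables (c : V -> bool) (n : nat).
Hypotheses (ec : forall x y, e x y -> c y = ~~ c x) (Ln : L = n.*2).

Lemma winds_color i : c (f i) = c (f 0) (+) odd i.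
Proof. by elim: i => [|i IH]; rewrite ?addbF // (ec (winds_arc i)) IH /= addbN. Qed.

(** The vertices of one colour on the cycle are f(a), f(a+2), f(a+4), ..., so a
    set of such vertices amounts to a predicate of period [n], half the length.
    *)
Lemma card_color_class (S : {set V}) a :
    (forall v, v \in S -> exists i, v = f i) -> {in S, forall v, c v = c (f a)} ->
  #|S| <= count (fun k => f (a + k.*2) \in S) (iota 0 n).
Proof.
move=> Sf Sc; apply: (@card_le_count _ _ (fun k => f (a + k.*2))) => v vS.
have [i vi] := Sf v vS; have [j /andP[aj jL] fj] := seg_index a i.
have : odd j = odd a.
  have := Sc v vS; rewrite vi -fj winds_color [in RHS]winds_color.
  by case: (c (f 0)); case: (odd j); case: (odd a).
move=> par; have jE : a + ((j - a)./2).*2 = j.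
  by rewrite -[RHS](subnKC aj) -{2}(odd_double_half (j - a)) oddB // par addbb.
exists ((j - a)./2); rewrite jE fj -?vi // vS andbT mem_iota /= add0n.
by rewrite -ltn_double -Ln; lia.
Qed.

(** [periodic_gap] for two sets of vertices on the cycle, each on one side of
    the bipartition; distances from the first to the second all have the parity
    of [g], so consecutive ones differ by 2. *)
Lemma gap_between (A B : {set V}) g h :
    (forall v, v \in A -> exists i, v = f i) ->
    (forall v, v \in B -> exists i, v = f i) ->
    {in A & B, forall v w, c w = c v (+) odd g} ->
    A != set0 -> B != set0 -> 0 < h -> n.+1 < #|A| + #|B| + h ->
  exists i m, [/\ m < h, f i \in A & f (i + g + m.*2) \in B].
Proof.
move=> Af Bf ABc /set0Pn[a Aa] /set0Pn[b Bb] h0 big.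
have [i0 ai0] := Af a Aa.
have leA : #|A| <= count (fun k => f (i0 + k.*2) \in A) (iota 0 n).
  apply: card_color_class => // v Av; rewrite -ai0.
  have := ABc _ _ Av Bb; rewrite (ABc _ _ Aa Bb).
  by case: (c a); case: (c v); case: (odd g).
have leB : #|B| <= count (fun k => f (i0 + g + k.*2) \in B) (iota 0 n).
  apply: card_color_class => // v Bv; rewrite (ABc _ _ Aa Bv) ai0.
  by rewrite !(winds_color (_ + _)) winds_color oddD addbA.
have per j k : f (j + (k + n).*2) = f (j + k.*2).
  by rewrite doubleD -Ln addnA winds_addL.
have [|||||k [m [mh Ak Bk]]] := @periodic_gap (fun k => f (i0 + k.*2) \in A)
  (fun k => f (i0 + g + k.*2) \in B) n h _ _ _ _ h0.
- by move=> k; rewrite per.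
- by move=> k; rewrite per.
- by rewrite has_count; apply: leq_trans leA; apply/card_gt0P; exists a.
- by rewrite has_count; apply: leq_trans leB; apply/card_gt0P; exists b.
- by apply: leq_trans big _; rewrite leq_add2r leq_add.
exists (i0 + k.*2), m; split=> //.
by move: Bk; rewrite doubleD addnA (addnAC i0 g).
Qed.

End Colored.
End Winding.

(** * Longest cycles *)

(** Cut a path from [X] to [Y] after its last visit to [X], and then at its
    first visit to [Y]. *)
Lemma last_exit_first_entry (e : rel V) (X Y : {pred V}) x p :
    path e x p -> uniq p -> x \in X ->
    last x p \in Y -> {in X, forall v, v \notin Y} ->
  exists x' q y, [/\ x' \in X, y \in Y, path e x' (rcons q y), uniq q &
     {in q, forall v, v \notin X /\ v \notin Y}].
Proof.
have [k] := ubnP (size p); elim: k x p => // k IH x p; rewrite ltnS => pk.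
move=> pp up xX lY XY.
have [hX|nX] := boolP (has (mem X) p).
  have [x' [p1 [p2 [E x'X _]]]] := first_split hX.
  move: pk pp up lY; rewrite E size_cat cat_path last_cat cat_uniq /=.
  move=> pk /and3P[_ _ p2p] /and3P[_ _ /andP[_ up2]] lY.
  by apply: (IH x' p2) => //; lia.
have hY : has (mem Y) p.
  case/lastP: p lY {pk pp up nX} => [|p y]; first by move=> /= /(negP (XY x xX)).
  by rewrite last_rcons has_rcons => yY; apply/orP; left.
have [y [p1 [p2 [E yY nY]]]] := first_split hY.
move: pp up nX; rewrite E -cat_rcons cat_path cat_uniq rcons_uniq has_cat has_rcons.
move=> /andP[pp _] /andP[/andP[_ up1] _] /norP[/norP[_ nX] _].
exists x, p1, y; split=> // v vp; split; first exact: (hasPn nX).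
exact: (hasPn nY).
Qed.

(** When all the neighbours of f(0) are on the cycle, they are 2d vertices of
    one side of the bipartition, that is, at odd distances. Hence the cycle has
    length at least 4d. If it is also at least 2s long, then a chord at f(0)
    joining vertices more than t apart in both directions gives a fork; without
    forks the 2d neighbours would be at odd distance at most t from f(0), and
    there are at most t + 1 such places. *)
Lemma isolated_cycle (e : rel V) c d f n :
    bip_semideg e c d -> winds e f n.*2 ->
    (forall y, e (f 0) y || e y (f 0) -> exists i, y = f i) ->
  4 * d <= n.*2 /\
  forall s t, 2 * s <= n.*2 -> t <= s -> t.+1 < 2 * d -> fork e s t.
Proof.
move=> eG; move LE: n.*2 => L fL nbr.
set N := [set y | e (f 0) y] :|: [set y | e y (f 0)].
have dN : d.*2 <= #|N|.
  rewrite cardsU disjoint_setI0 ?cards0 ?subn0 -?addnn.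
    by apply: leq_add; [apply: (outdeg_ge eG) | apply: (indeg_ge eG)].
  rewrite -setI_eq0; apply/eqP/setP => y; rewrite !inE.
  by apply/negP=> /andP[/(arc_asym eG)/negP].
have NP y : y \in N -> e (f 0) y || e y (f 0) by rewrite !inE.
have Nodd y j : y \in N -> y = f j -> odd j.
  move=> /NP yN yj; have := winds_color fL (arc_color eG) j; rewrite -yj.
  case/orP: yN => /(arc_color eG) ->; first by case: (c _); case: (odd j).
  by case: (c y); case: (odd j).
have NL y : y \in N -> exists2 j, j < L & y = f j.
  by case/NP/nbr=> i ->; have [j] := seg_index fL 0 i; exists j.
split.
  have : #|N| <= count (fun i => odd i == true) (iota 0 L).
    apply: (@card_le_count _ _ f) => y yN; have [j jL yj] := NL y yN; exists j => //.
    by rewrite mem_iota /= add0n jL (Nodd y).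
  have := count_parity_iota true 0 L; move: dN; rewrite -LE.
  by move: #|_| (count _ _); clear; lia.
move=> s t sL ts td.
pose near j := (0 < j < L) && (e (f 0) (f j) || e (f j) (f 0)) ==>
  (j <= t) || (L - t <= j).
have mk j : 0 < j < L -> e (f 0) (f j) || e (f j) (f 0) ->
    exists2 g, (g == j) || (g == L - j) & fork e g.-1 (L - g).
  move=> jL /orP[ej|ej].
    by exists j; rewrite ?eqxx //; apply: (winds_chord_fork fL _ ej); move: jL; clear; lia.
  exists (L - j); rewrite ?eqxx ?orbT //; apply: (@winds_chord_fork _ _ _ fL j).
    by move: jL; clear; lia.
  by rewrite subnKC ?(winds_addL fL 0) // ltnW //; case/andP: jL.
have [/allP nearP|/allPn[j _]] := boolP (all near (iota 0 L)); last first.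
  rewrite negb_imply => /andP[/andP[jL ej] jt].
  have [g gj fg] := mk j jL ej.
  have [gs|sg] := leqP g (L - s).
    by apply/forkC/(forkW fg); move: sL ts jt gj jL gs; clear; lia.
  by apply: (forkW fg); move: sL ts jt gj jL sg; clear; lia.
(* Positions 1, ..., t after f(0), and L-t, ..., L-1 before its next copy. *)
have : #|N| <= count (fun i => odd i == true) (iota 1 t ++ iota (L - t) t).
  apply: (@card_le_count _ _ f) => y yN; have [j jL yj] := NL y yN; exists j => //.
  have oj := Nodd y j yN yj; rewrite oj eqxx andbT mem_cat !mem_iota.
  have j0 : 0 < j by case: (j) oj.
  have : near j by apply: nearP; rewrite mem_iota.
  rewrite /near j0 jL -yj NP //=; move: sL ts j0 jL; clear; lia.
rewrite count_cat; have := count_parity_iota true 1 t.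
have := count_parity_iota true (L - t) t.
by move: dN td; move: #|N| (count _ _) (count _ _); clear; lia.
Qed.

Lemma card_exits (e : rel V) c d z p : bip_semideg e c d -> path e z p ->
  d.*2 < #|[set y in [predC z :: p] | e (last z p) y]|.*2 + size (z :: p).
Proof.
move=> eG zp; set B := [set y in [predC _] | _].
have := card_outnbrs_on_path eG zp; set N := [set y in _ | _].
have : d <= #|N| + #|B|.
  apply: leq_trans (outdeg_ge eG (last z p)) _.
  apply: leq_trans (leq_card_setU _ _); apply: subset_leq_card; apply/subsetP => v.
  rewrite [v \in _]inE => ev; apply/setUP.
  by case: (boolP (v \in z :: p)) => vp; [left|right]; apply/setIdP.
by move: #|N| #|B| (size _); clear; lia.
Qed.

Lemma last_rev_belast z p : last (last z p) (rev (belast z p)) = z.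
Proof. by case: p => //= a p'; rewrite rev_cons last_rcons. Qed.

Lemma mem_rev_belast z p : last z p :: rev (belast z p) =i z :: p.
Proof. by move=> y; rewrite in_cons mem_rev lastI mem_rcons in_cons. Qed.

Lemma card_entries (e : rel V) c d z p : bip_semideg e c d -> path e z p ->
  d.*2 < #|[set y in [predC z :: p] | e y z]|.*2 + size (z :: p).
Proof.
move=> eG zp; have := card_exits (bip_semideg_rev eG) (path_rev zp).
rewrite /= size_rev size_belast last_rev_belast.
congr (_ < _.*2 + _); apply: eq_card => y; rewrite /arev.
by apply/setIdP/setIdP=> -[]; rewrite !inE -!in_cons mem_rev_belast.
Qed.

(** In this section the path [z :: p], on [r] vertices, is disjoint from the
    cycle [f], and the arcs that leave its last vertex or enter its first one
    have their other end on it or on the cycle. *)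
Section Detour.
Variables (e : rel V) (c : V -> bool) (d : nat).
Hypothesis eG : bip_semideg e c d.
Variables (f : nat -> V) (n : nat).
Let L := n.*2.
Hypothesis fL : winds e f L.
Variables (z : V) (p : seq V).
Let r := size (z :: p).
Hypotheses (zp : path e z p) (uzp : uniq (z :: p)) (off : forall i, f i \notin z :: p).
Hypothesis outP : forall y, e (last z p) y -> y \notin z :: p -> exists i, y = f i.
Hypothesis inP : forall y, e y z -> y \notin z :: p -> exists i, y = f i.

(** Each end of the path has more than d - r/2 neighbours on the cycle by
    [card_entries] and [card_exits]. A distance from an entry to an exit has the
    parity of r + 1, because the passage through the path has r + 1 arcs and the
    digraph is bipartite. *)
Lemma detour_gap g h : r <= d.*2 -> odd g = ~~ odd r -> 0 < h ->
    L + 2 * r < 4 * d + 2 * h ->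
  exists i m, [/\ m < h, e (f i) z & e (last z p) (f (i + g + m.*2))].
Proof.
move=> rd godd h0 big.
set A := [set y in [predC z :: p] | e y z].
set B := [set y in [predC z :: p] | e (last z p) y].
have cA : d.*2 < #|A|.*2 + r := card_entries eG zp.
have cB : d.*2 < #|B|.*2 + r := card_exits eG zp.
have [||||||i [m [mh /setIdP[_ Ai] /setIdP[_ Bi]]]] :=
  @gap_between e f L fL c n (arc_color eG) (erefl _) A B g h _ _ _ _ _ h0.
- by move=> v /setIdP[vp ev]; apply: inP.
- by move=> v /setIdP[vp ev]; apply: outP.
- move=> v w /setIdP[_ ev] /setIdP[_ ew].
  rewrite (arc_color eG ew) (last_nth z) (path_color eG zp) // (arc_color eG ev).
  by rewrite godd /r /=; case: (c v); case: (odd (size p)).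
- by rewrite -card_gt0; move: cA rd; move: r #|A|; clear; lia.
- by rewrite -card_gt0; move: cB rd; move: r #|B|; clear; lia.
- by move: cA cB big; rewrite /L; move: r #|A| #|B|; clear; lia.
by exists i, m.
Qed.

(** In a longest cycle, a passage through the path cannot bypass r or fewer arcs
    of the cycle. So the distances of the right parity in 1, ..., r do not
    occur. *)
Lemma longest_cycle_detour :
    (forall s, cycle e s -> uniq s -> size s <= L) -> r <= d.*2 -> d.*2 < L ->
  4 * d <= L + r + 1.
Proof.
move=> Lmax rd dL; rewrite leqNgt; apply/negP => small.
have r0 : 0 < r by [].
have [r1|r1] := leqP r 1.
  (* For r = 1 no positive distance of the right parity is at most r; the
     forbidden distance is L, that is 0, since an entry f(i) with an arc back
     from [z] would make a cycle of length two. *)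
  have [||||i [m [mh ei ej]]] := @detour_gap L 1 => //.
  - by rewrite /L odd_double; case: (r) r1 r0 => [|[]].
  - by move: small r1; clear; lia.
  move: ej; case: m mh => // _; rewrite addn0 (winds_addL fL).
  have -> : last z p = z by move: r1; rewrite /r; case: (p).
  by move/(arc_asym eG); rewrite ei.
have [||||i [m [mh ei ej]]] := @detour_gap (odd r).+1 r./2 => //.
- by rewrite /= oddb.
- by move: r1; clear; lia.
- by move: small r1; clear; lia.
have gr : (odd r).+1 + m.*2 <= r by move: mh; clear; lia.
rewrite -addnA in ej.
have [|s /andP[/Lmax H /H]] := detour_cycle fL zp uzp off _ ei ej.
  by move: gr rd dL; clear; lia.
by move=> sL sE; move: sL; rewrite sE -/r; move: gr rd dL; clear; lia.
Qed.

(** By [detour_fork], if there is no fork then a passage from f(i) to f(i+g)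
    does not occur for t < g <= r+L-s. About half of these values have the right
    parity, and [detour_gap] then gives 4d <= s + t + r + 1, which contradicts
    8d >= 3(s+t) + 16 because r < t <= s. *)
Lemma short_detour_fork s t : r < t -> t <= s -> 3 * (s + t) + 16 <= 8 * d ->
  r <= d.*2 -> 4 * d <= L + r + 1 -> fork e s t.
Proof.
move=> rt ts hd rd long.
(* The least distance above t with the parity of r + 1. *)
pose g := t.+1 + (odd r == odd t.+1).
have gt : t.+1 <= g <= t.+2 by rewrite /g; case: (_ == _); clear; lia.
have [||||i [m [mh ei ej]]] := @detour_gap g ((r + L - s - g)./2.+1) => //.
- by rewrite /g oddD; case: (odd r); case: (odd t.+1).
- by move: rt ts hd long gt; clear; lia.
rewrite -addnA in ej.
have gm : t < g + m.*2 <= r + L - s by move: mh rt ts hd long gt; clear; lia.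
have gL : 0 < g + m.*2 <= L by move: gm rt ts; clear; lia.
have fk := detour_fork fL zp uzp off gL ei ej.
by apply/forkC/(forkW fk); rewrite -?/r; move: gm rt ts; clear; lia.
Qed.

End Detour.

Lemma winds_even (e : rel V) c f L : (forall x y, e x y -> c y = ~~ c x) ->
  winds e f L -> L = L./2.*2.
Proof.
move=> ec fL; have := winds_color fL ec L; rewrite -{1}[L]add0n (winds_addL fL 0).
move=> fLc; have oL : odd L = false by move: fLc; case: (c _); case: (odd L).
by rewrite -[LHS]odd_double_half oL.
Qed.

(** The path contains a cycle, formed by the in-neighbours of its start as in
    [end_cycle]. A path from [C] that reaches this cycle goes once around it. *)
Lemma exit_around_cycle (e : rel V) c d z p (C : {pred V}) x0 :
    bip_semideg e c d -> 0 < d -> path e z p -> uniq (z :: p) ->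
    (forall y, e y z -> y \in z :: p) ->
    {in z :: p, forall v, v \notin C} -> x0 \in C ->
    (forall v, v \in z :: p -> connect e x0 v) ->
  exists x q, [/\ x \in C, path e x q, uniq q, {in q, forall v, v \notin C}
    & d.*2 < size q].
Proof.
move=> eG d0 zp uzp inz zC x0C x0z.
have up' : uniq (last z p :: rev (belast z p)).
  by rewrite -rev_rcons -lastI rev_uniq.
have [|p1 [y [p2 [E py ey sy]]]] := end_cycle (bip_semideg_rev eG) (path_rev zp) _ d0.
  by move=> v; rewrite last_rev_belast mem_rev_belast; apply: inz.
have Zz v : v \in y :: p2 -> v \in z :: p.
  by move=> vy; rewrite -mem_rev_belast E mem_cat vy orbT.
have uy : uniq (y :: p2) by move: up'; rewrite E cat_uniq => /and3P[].
have /connectP[p0 pp0 lp0] := x0z y (Zz y (mem_head _ _)).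
case: (shortenP pp0) lp0 => p' pp' /andP[_ up0] _ lp'.
have [||x [q [w [xC wZ pq uq qX]]]] :=
  last_exit_first_entry (Y := mem (y :: p2)) pp' up0 x0C.
- by rewrite -lp' mem_head.
- by move=> v vC; apply/negP => /Zz/zC; rewrite vC.
have cyc : cycle e (rev (y :: p2)).
  by rewrite rev_cycle /= rcons_path py.
have wZ' : w \in rev (y :: p2) by rewrite mem_rev.
case: (rot_to wZ') => i s rotE.
have sw : w :: s =i y :: p2 by move=> v; rewrite -rotE mem_rot mem_rev.
exists x, (q ++ w :: s); split=> //.
- rewrite -cat_rcons cat_path pq last_rcons.
  have : cycle e (w :: s) by rewrite -rotE rot_cycle.
  by rewrite /= rcons_path => /andP[].
- rewrite cat_uniq uq -rotE rot_uniq rev_uniq uy andbT.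
  by apply/hasPn => v; rewrite mem_rot mem_rev => vy; apply/negP => /qX[_ /negP].
- move=> v; rewrite mem_cat sw => /orP[/qX[]//|/Zz]; exact: zC.
- rewrite size_cat -rotE size_rot size_rev; apply: leq_trans sy _; exact: leq_addl.
Qed.

(** * Existence of forks *)

(** Every component is strongly connected here. Let [C] be a longest cycle. If
    it covers its component, then [isolated_cycle] applies. If not, let [z :: p]
    be a longest path, on r vertices, in the rest of the component; the arcs that
    leave its last vertex or enter its first one have their other end on it or
    on [C]. There is a path [q] leaving [C] with at least min(r, 2d+1) vertices
    off [C]. Going around [C] and then along [q] makes the long path: [C] has
    more than 2d vertices, and |C| + r >= 4d - 1 when r <= 2d by
    [longest_cycle_detour]. A fork is formed by [C] and [q] if [q] has at least t
    vertices, and otherwise r < t and [short_detour_fork] applies. *)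
Lemma two_way_arcs (e : rel V) c d x0 :
    bip_semideg e c d -> 0 < d -> (forall u w, e u w -> connect e w u) ->
  (exists x p, [/\ path e x p, uniq (x :: p) & 4 * d <= (size p).+2]) /\
  forall s t, s <= d.*2 -> t <= s -> 3 * (s + t) + 16 <= 8 * d -> fork e s t.
Proof.
move=> eG d0 esym.
have [|| C /andP[cC uC] Cmax] := @ex_longest V (fun s => cycle e s && uniq s) [::].
- by [].
- by move=> s /andP[].
have dC : d.*2 < size C.
  have [p [pp up _ outp]] := maximal_path e pred0 x0.
  have [|p1 [z [p2 [E pz ez sz]]]] := end_cycle eG pp _ d0.
    by move=> y ey; apply: outp.
  apply: leq_trans sz (Cmax _ _); rewrite /= rcons_path pz ez /=.
  by move: up; rewrite E cat_uniq => /and3P[].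
have C0 : C != [::] by case: (C) dC.
have [f fL fC] := cycle_winds cC uC C0.
have Leven := winds_even (arc_color eG) fL.
move: Leven; set n := (size C)./2 => Ln; rewrite Ln in fL dC.
have f0C : f 0 \in C by apply/fC; exists 0.
have [U UE] : {U : pred V | forall v, U v = connect e (f 0) v && (v \notin C)} by eexists.
have outU u v : U u -> e u v -> v \notin C -> U v.
  by rewrite !UE => /andP[cu _] euv vC; rewrite vC andbT (connect_trans cu) ?connect1.
have inU u v : U u -> e v u -> v \notin C -> U v.
  by rewrite !UE => /andP[cu _] /esym euv vC; rewrite vC andbT (connect_trans cu).
have [u0 Uu0|U0] := pickP U; last first.
  have [|Ld fk] := isolated_cycle eG fL.
    move=> y ey; apply/fC; apply: contraT => yC; move: (U0 y); rewrite UE yC andbT.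
    by case/orP: ey => [/connect1|/esym] ->.
  split; last by move=> s t sd ts hd; apply: fk => //; lia.
  exists (f 0), (seg f 1 n.*2.-1); split.
  - exact: (path_seg fL).
  - rewrite -[f 0 :: _]/(seg f 0 n.*2.-1.+1); apply: (uniq_seg fL); lia.
  - by rewrite size_seg; lia.
have [|| R /and3P[sR uR /allP UR] Rmax] :=
    @ex_longest V (fun s => [&& sorted e s, uniq s & all U s]) [:: u0].
- by rewrite /= Uu0.
- by move=> s /and3P[].
case: R sR uR UR Rmax => [|z p] zp uzp UR Rmax.
  by have := Rmax [:: u0]; rewrite /= Uu0 => /(_ isT).
have {}zp : path e z p := zp.
have allR : all U (z :: p) by apply/allP.
have zpC v : v \in z :: p -> v \notin C by move/UR; rewrite UE => /andP[].
have outR y : e (last z p) y -> y \notin z :: p -> y \in C.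
  move=> ey yR; apply: contraT => yC; have Uy := outU _ _ (UR _ (mem_last z p)) ey yC.
  suff /Rmax : [&& sorted e (rcons (z :: p) y), uniq (rcons (z :: p) y)
                 & all U (rcons (z :: p) y)] by rewrite size_rcons ltnn.
  by rewrite rcons_uniq yR uzp all_rcons Uy allR andbT /= rcons_path zp ey.
have inR y : e y z -> y \notin z :: p -> y \in C.
  move=> ey yR; apply: contraT => yC; have Uy := inU _ _ (UR _ (mem_head z p)) ey yC.
  suff /Rmax : [&& sorted e (y :: z :: p), uniq (y :: z :: p) & all U (y :: z :: p)].
    by rewrite /= ltnn.
  by rewrite cons_uniq yR uzp -cat1s all_cat allR /= Uy ey zp.
have off i : f i \notin z :: p.
  by apply/negP => /zpC/negP; apply; apply/fC; exists i.
have outF y : e (last z p) y -> y \notin z :: p -> exists i, y = f i.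
  by move=> ey /(outR _ ey)/fC.
have inF y : e y z -> y \notin z :: p -> exists i, y = f i.
  by move=> ey /(inR _ ey)/fC.
(* If no arc enters [z] from [C], then all the in-neighbours of [z] are on the
   path, which therefore contains a cycle. *)
have [x [q [xC pq uq qC sq]]] : exists x q, [/\ x \in C, path e x q, uniq q,
    {in q, forall v, v \notin C} & minn (size (z :: p)) d.*2.+1 <= size q].
  have [/hasP[x xC exz]|nC] := boolP (has (fun x => e x z) C).
    by exists x, (z :: p); split; rewrite //= ?exz // geq_minl.
  have [||||x [q [? ? ? ? sq]]] :=
    @exit_around_cycle e c d z p (mem C) (f 0) eG d0 zp uzp.
  - move=> y eyz; apply: contraT => /(inR _ eyz) yC; case/negP: nC.
    by apply/hasP; exists y.
  - exact: zpC.
  - exact: f0C.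
  - by move=> v /UR; rewrite UE => /andP[].
  by exists x, q; split=> //; apply: leq_trans (geq_minr _ _) sq.
have [i xi] := (fC x).1 xC; subst x.
have segC a l v : v \in seg f a l -> v \in C.
  by case/mapP=> j _ ->; apply/fC; exists j.
have uCq a l : l <= n.*2 -> uniq (seg f a l ++ q).
  move=> ln; rewrite cat_uniq (uniq_seg fL) // uq andbT.
  by apply/hasPn => v /qC vC; apply: contra vC; apply: segC.
have nK : n.*2.-1.+1 = n.*2 by move: dC; clear; lia.
have short : size (z :: p) <= d.*2 -> 4 * d <= n.*2 + size (z :: p) + 1.
  move=> rd; apply: (longest_cycle_detour eG fL zp uzp off outF inF) => //.
  by move=> s cs us; rewrite -Ln; apply: Cmax; rewrite cs.
split.
  exists (f i.+1), (seg f i.+2 n.*2.-1 ++ q).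
  have iL : i.+1 + n.*2.-1 = i + n.*2 by rewrite addSnnS nK.
  split.
  - by rewrite cat_path (path_seg fL) (last_seg f) iL (winds_addL fL).
  - by rewrite -cat_cons -[f i.+1 :: _]/(seg f i.+1 n.*2.-1.+1) nK; apply: uCq.
  rewrite size_cat size_seg; move: short sq dC.
  by move: (size (z :: p)) (size q); clear; lia.
move=> s t sd ts hd; have [tq|qt] := leqP t (size q).
  exists (f i), (seg f i.+1 n.*2.-1), q; split=> //.
  - exact: (path_seg fL).
  - by rewrite -cat_cons -[f i :: _]/(seg f i n.*2.-1.+1) nK; apply: uCq.
  - by rewrite size_seg; move: dC sd; clear; lia.
have rt : size (z :: p) < t.
  by move: sq qt ts sd; move: (size (z :: p)) (size q); clear; lia.
have rd : size (z :: p) <= d.*2 by apply: leq_trans (ltnW rt) (leq_trans ts sd).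
exact: (short_detour_fork eG fL zp uzp off outF inF rt ts hd rd (short rd)).
Qed.

(** For t < d the long path suffices. For t >= d the bound on d makes s at most
    2d, so that a cycle with more than 2d vertices accommodates the longer
    branch. *)
Lemma fork_exists (e : rel V) c d x0 s t :
  bip_semideg e c d -> 3 * (s + t) + 16 <= 8 * d -> fork e s t.
Proof.
move=> eG; wlog ts : s t / t <= s.
  move=> H; have [|/ltnW] := leqP t s; first exact: H.
  by move=> st hd; apply: forkC; apply: H => //; rewrite (addnC t).
move=> hd; have d0 : 0 < d by lia.
have [lp fk] :
  (exists x p, [/\ path e x p, uniq (x :: p) & 4 * d <= (size p).+2]) /\
  forall s t, s <= d.*2 -> t <= s -> 3 * (s + t) + 16 <= 8 * d -> fork e s t.
  have [/forallP symP|] := boolP [forall u, forall w, e u w ==> connect e w u].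
    apply: (two_way_arcs x0 eG d0) => u w; apply/implyP.
    exact: (forallP (symP u)) w.
  rewrite negb_forall => /existsP[u]; rewrite negb_forall => /existsP[w].
  rewrite negb_imply => /andP[euw Nwu].
  have [[x [p [pp up sp]]] fk] := one_way_arc eG euw Nwu d0.
  split; first by exists x, p.
  by move=> s' t' sd ts' _; apply: (forkW fk) => //; apply: leq_trans sd.
have [td|dt] := ltnP t d.
  case: lp => x [p [pp up sp]]; exact: (long_path_fork eG pp up sp hd td ts).
by apply: fk => //; lia.
Qed.

(** * Two-block paths from forks *)

Lemma contains_oriented_path (e : rel V) (w : seq bool) (W : seq V) x0 :
    size W = (size w).+1 -> uniq W ->
    (forall i, i < size w -> if nth false w i then e (nth x0 W i) (nth x0 W i.+1)
                             else e (nth x0 W i.+1) (nth x0 W i)) ->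
  contains e (oriented_path w).
Proof.
move=> sW uW arc; exists (fun i : 'I_(size w).+1 => nth x0 W i); split.
  by move=> i j /eqP; rewrite nth_uniq ?sW // => /eqP/val_inj.
move=> i j; rewrite /oriented_path => /orP[/andP[/eqP ji wi]|/andP[/eqP ij wj]].
  have := arc i; rewrite wi ji; apply; rewrite -ltnS -ji; exact: ltn_ord.
have := arc j; rewrite (negbTE wj) ij; apply; rewrite -ltnS -ij; exact: ltn_ord.
Qed.

(** The word read along the path is [b] on the branch of length [s], traversed
    towards the centre of the fork, and [~~ b] on the other; so [b = true]
    requires the arcs of both branches to be reversed. *)
Lemma fork_contains (e : rel V) s t b :
    fork (if b then arev e else e) s t ->
  contains e (oriented_path (nseq s b ++ nseq t (~~ b))).
Proof.
set e' := if b then _ else _; case=> v [p0 [q0 [pp pq up sp sq]]].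
set p := take s p0; set q := take t q0.
have {}sp : size p = s by rewrite size_takel.
have {}sq : size q = t by rewrite size_takel.
have {}pp : path e' v p.
  by move: pp; rewrite -{1}(cat_take_drop s p0) cat_path => /andP[].
have {}pq : path e' v q.
  by move: pq; rewrite -{1}(cat_take_drop t q0) cat_path => /andP[].
have {}up : uniq (v :: p ++ q).
  by apply: subseq_uniq up; rewrite /= eqxx cat_subseq ?take_subseq.
(* The vertices in the order of the oriented path; the centre is at position s. *)
pose W := rev p ++ v :: q.
have WE : W = rev (v :: p) ++ q by rewrite rev_cons cat_rcons.
have Wl i : i <= s -> nth v W i = nth v (v :: p) (s - i).
  by move=> is_; rewrite WE nth_cat size_rev /= sp ltnS is_ nth_rev /= sp ?ltnS.
have Wr i : nth v W (s + i) = nth v (v :: q) i.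
  by rewrite /W nth_cat size_rev sp ltnNge leq_addr /= addKn.
apply: (@contains_oriented_path _ _ W v).
- by rewrite /W size_cat size_rev /= size_cat !size_nseq sp sq addnS.
- rewrite (perm_uniq (s2 := v :: p ++ q)) //.
  by rewrite WE -cat_cons perm_cat2r perm_rev.
move=> i; rewrite size_cat !size_nseq nth_cat size_nseq => ist.
have [si|is_] := leqP s i.
  have [j jt ->] : exists2 j, j < t & i = s + j by exists (i - s); lia.
  rewrite -addnS !Wr addKn nth_nseq jt /=.
  have /(pathP v)/(_ j) := pq; rewrite sq => /(_ jt).
  by rewrite /e'; case: (b).
rewrite nth_nseq is_ !Wl ?(ltnW is_) //.
have -> : s - i = (s - i.+1).+1 by lia.
have /(pathP v)/(_ (s - i.+1)) := pp; rewrite sp => /(_ _); rewrite /e' /=.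
by case: (b) => /=; apply; lia.
Qed.

End Digraphs.

Theorem theorem1p2 (k : nat) (hk : 2 <= k) (V : finType) (e : rel V)
    (oriented_e : oriented_graph e) (bipartite_e : bipartite e)
    (semideg_e : (3%:R * k%:R / 8%:R + 2%:R <= (min_semideg e)%:R :> rat)%R) :
  forall s t : nat, 1 <= s -> 1 <= t -> s + t = k ->
    contains e (P s t) /\ contains e (Q s t).
Proof.
move=> s t _ _ stk; set d := min_semideg e in semideg_e.
have hd : 3 * (s + t) + 16 <= 8 * d.
  rewrite stk; move: semideg_e.
  have -> : (3%:R * k%:R / 8%:R + 2%:R = (3 * k + 16)%:R / 8%:R :> rat)%R.
    rewrite (_ : 2%:R = 16%:R / 8%:R)%R; last by apply/eqP.
    by rewrite -GRing.mulrDl -GRing.natrM -GRing.natrD.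
  by rewrite Num.Theory.ler_pdivrMr // -GRing.natrM Num.Theory.ler_nat (mulnC d).
case: bipartite_e => V1 [V2 [cover12 dis12 arc12]].
have eG : bip_semideg e (fun x => x \in V1) d.
  have V2E x : (x \in V2) = (x \notin V1).
    have := in_setT x; rewrite -cover12 inE.
    by case: (boolP (x \in V1)) => //= xV1 _; apply: (disjointFr dis12).
  split=> [x y|x y|x|x].
  - by move/arc12; rewrite !V2E; case: (x \in V1); case: (y \in V1).
  - by move=> exy; have [_ /(_ x y)] := oriented_e; rewrite exy.
  - by apply: leq_trans (geq_minl _ _) (bigminn_le _ _ _); rewrite mem_index_enum.
  - by apply: leq_trans (geq_minr _ _) (bigminn_le _ _ _); rewrite mem_index_enum.
have [x0 _] : exists x0 : V, x0 \in V.
  have dV : d <= #|V| by apply: leq_trans (geq_minl _ _) (bigminn_le_idx _ _ _).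
  by apply/card_gt0P; apply: leq_trans dV; move: hd; clear; lia.
split; first exact: (fork_contains (b := true) (fork_exists x0 (bip_semideg_rev eG) hd)).
exact: (fork_contains (b := false) (fork_exists x0 eG hd)).
Qed.
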